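(* For any cardinal $\kappa\ge\omega$ and natural number $m$, $w\chi_{\rm CF}(\beth_m(\kappa),\kappa,2)\ge\left\lfloor m/2\right\rfloor+2$.
   Context: $\beth_0(\kappa)=\kappa$, $\beth_{r+1}(\kappa)=2^{\beth_r(\kappa)}$. A weak conflict free coloring of a family $\mathcal A$ with $\rho$ colors is a function $f$ with $\operatorname{dom}(f)\subseteq\bigcup\mathcal A$, values in $\rho$, such that every $A\in\mathcal A$ has some $\zeta$ with $|A\cap f^{-1}\{\zeta\}|=1$; $w\chi_{\rm CF}(\mathcal A)$ is the least such $\rho$. A $(\lambda,\kappa,\mu)$-system is a family of $\lambda$ sets each of size $\kappa$, distinct members meeting in fewer than $\mu$ points; $w\chi_{\rm CF}(\lambda,\kappa,\mu)$ is the supremum of $w\chi_{\rm CF}(\mathcal A)$ over all $(\lambda,\kappa,\mu)$-systems. *)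

(* Defs.v *)
From HB Require Import structures.
From mathcomp Require Import all_boot.
From mathcomp Require Import boolp classical_sets cardinality.
Set Implicit Arguments. Unset Strict Implicit. Unset Printing Implicit Defensive.
Local Open Scope classical_set_scope.
Local Open Scope card_scope.

(* beth_m(kappa) realised as a type: iterated power set of a type K of
   cardinality kappa (|set X| = |X -> Prop| = 2^|X| classically). *)
Fixpoint bethT (m : nat) (K : Type) : Type :=
  match m with
  | 0 => K
  | r.+1 => set (bethT r K)
  end.

(* A (lambda, kappa, mu)-system on points of type T, indexed by I, with
   |I| = lambda (injective indexing = a family of lambda distinct sets),
   kappa = |K|, and mu = 2: members of size kappa, distinct members meeting
   in fewer than 2 points (i.e. at most one point). *)
Definition system_2 (I K T : Type) (F : I -> set T) : Prop :=
  [/\ injective F,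
      (forall i, F i #= [set: K]) &
      (forall i j, i <> j -> forall x y,
          F i x -> F j x -> F i y -> F j y -> x = y)].

(* f : T -> option 'I_rho is a partial colouring with rho colours
   (None = uncoloured, i.e. outside dom f); it is weak conflict free for the
   family F if every member meets some colour class in exactly one point. *)
Definition weak_CF_coloring (I T : Type) (F : I -> set T) (rho : nat)
  (f : T -> option 'I_rho) : Prop :=
  forall i, exists zeta : 'I_rho, exists! x, F i x /\ f x = Some zeta.

Definition wchiCF_ge (I T : Type) (F : I -> set T) (n : nat) : Prop :=
  forall rho : nat, (rho < n)%N ->
    ~ exists f : T -> option 'I_rho, weak_CF_coloring F f.

(* Main.v *)
(* Each step of two power sets costs one more colour.  Let [F] be a system of
   |I| sets without a weak conflict free colouring with n colours.  If both members of
   a pair {x_i, y_i} of new points attached to [F i] have the same colour c, then c is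
   useless for every extended set, so that n + 1 colours do not suffice either.
   To force such pairs, fix a "node" X, which is a sequence of 2^|I| old points for each
   colour.  Attach to X a batch of 2^|I| disjoint sets of size |K|; each of them contains
   a coloured point, so 2^|I| points of the batch have a common colour c.  For every
   colour c and every sequence s : I -> batch add a copy of [F] in which the i-th set
   receives the points X(c, s, i) and s i.  The points X(c, s, i) are distinct, which
   keeps the sets almost disjoint.  There are enough nodes for some X to consist
   of points of colour c in its c-th sequence, for all the colours c which occur
   2^|I| times among the old points; hence the colour of the new batch is a colour that was
   not that frequent before.  After more iterations than there are colours this is impossible.
   The first colour needs no power set, because the pairs can be listed outright. *)
Require Import Defs.
From mathcomp Require Import all_boot.
From mathcomp Require Import boolp classical_sets cardinality.
Set Implicit Arguments. Unset Strict Implicit. Unset Printing Implicit Defensive.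
Local Open Scope classical_set_scope.
Local Open Scope card_scope.

(** * Cardinal arithmetic *)

Definition embeds (A B : Type) : Prop := exists f : A -> B, injective f.

Lemma embeds_refl A : embeds A A.
Proof. by exists id. Qed.

Lemma embeds_trans B A C : embeds A B -> embeds B C -> embeds A C.
Proof. by move=> [f fI] [g gI]; exists (g \o f); apply: inj_comp. Qed.

Lemma embeds_prod A B A' B' :
  embeds A A' -> embeds B B' -> embeds (A * B) (A' * B').
Proof.
move=> [f fI] [g gI]; exists (fun p => (f p.1, g p.2)).
by case=> [a b] [a' b'] [/fI -> /gI ->].
Qed.

Lemma embeds_fun A B B' : embeds B B' -> embeds (A -> B) (A -> B').
Proof.
move=> [g gI]; exists (fun h => g \o h) => h h' e.
by apply: funext => a; apply: gI; apply: (congr1 (@^~ a) e).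
Qed.

Lemma embeds_set A B : embeds A B -> embeds (set A) (set B).
Proof.
move=> [f fI]; exists (fun X => f @` X) => X Y e; apply/seteqP; split=> x Xx.
  have : (f @` Y) (f x) by rewrite -e; exists x.
  by case=> y Yy /fI <-.
have : (f @` X) (f x) by rewrite e; exists x.
by case=> y Yy /fI <-.
Qed.

Lemma embeds_set1 A : embeds A (set A).
Proof.
exists (fun a => [set a]) => a b e.
by have : [set b] a by rewrite -e.
Qed.

Lemma embeds_uncurry A B : embeds (A -> set B) (set (A * B)).
Proof.
exists (fun h p => h p.1 p.2) => h h' e.
apply: funext => a; apply: funext => b; exact: (congr1 (@^~ (a, b)) e).
Qed.

Lemma embeds_sig A (P : A -> Prop) : embeds {x | P x} A.
Proof. by exists sval => -[x px] [y py] /= e; apply: eq_exist. Qed.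

(** A maximal partial injection, given by its graph, is total or onto: otherwise a missed point of
    [A] could be paired with a missed point of [B]. *)
Lemma embeds_total A B : embeds A B \/ embeds B A.
Proof.
pose P (G : set (A * B)) := forall p q, G p -> G q -> p.1 = q.1 <-> p.2 = q.2.
have [|G [PG Gmax]] := @Zorn_bigcup _ P.
  move=> F FP Ftot p q [G FG Gp] [G' FG' Gq].
  by have [/(_ p Gp)|/(_ q Gq)] := Ftot _ _ FG FG' => ?; [apply: (FP _ FG')|apply: (FP _ FG)].
have [domT|] := pselect (forall a, exists b, G (a, b)).
  have [f fG] := choice domT; left; exists f => a a' e.
  by have /= [_ ->] := PG _ _ (fG a) (fG a').
move=> /existsNP[a /forallNP aN]; right.
have ranT b : exists a, G (a, b).
  apply: contrapT => /forallNP bN.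
  have : ~ P (G `|` [set (a, b)]).
    by apply: Gmax; split=> [p Gp|/(_ (a, b) (or_intror erefl)) /aN]; first left.
  apply=> -[a1 b1] [a2 b2] [G1|[-> ->]] [G2|[-> ->]] /=.
  - exact: (PG _ _ G1 G2).
  - by split=> e; subst; [case: (aN _ G1)|case: (bN _ G1)].
  - by split=> e; subst; [case: (aN _ G2)|case: (bN _ G2)].
  - by [].
have [f fG] := choice ranT; exists f => b b' e.
by have /= [-> ] := PG _ _ (fG b) (fG b').
Qed.

(** Infinite cardinals, in the form from which the absorption laws follow directly and which passes
    to power sets. *)
Definition idem (A : Type) : Prop := embeds nat A /\ embeds (A * A) A.

Section Idempotent.
Variable X : Type.
Hypothesis idX : idem X.

Lemma idem_prod A B : embeds A X -> embeds B X -> embeds (A * B) X.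
Proof. by move=> AX BX; apply: embeds_trans (embeds_prod AX BX) idX.2. Qed.

Lemma idem_fin (C : countType) : embeds C X.
Proof.
apply: (embeds_trans (B := nat)); last exact: idX.1.
by exists pickle; apply: pcan_inj pickleK.
Qed.

Lemma idem_sum A B : embeds A X -> embeds B X -> embeds (A + B) X.
Proof.
move=> [f fI] [g gI].
apply: embeds_trans (idem_prod (idem_fin bool) (embeds_refl X)).
exists (fun s => match s with inl a => (true, f a) | inr b => (false, g b) end).
by move=> [a|b] [a'|b'] //= [] => [/fI|/gI] ->.
Qed.

Lemma idem_option A : embeds A X -> embeds (option A) X.
Proof.
move=> AX; apply: embeds_trans (idem_sum (idem_fin unit) AX).
exists (fun s => if s is Some a then inr a else inl tt).
by move=> [a|] [a'|] //= [->].
Qed.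

Lemma idem_powerset : idem (set X).
Proof.
split; first exact: embeds_trans idX.1 (@embeds_set1 X).
apply: (embeds_trans (B := set (X + X))).
  exists (fun p s => match s with inl a => p.1 a | inr b => p.2 b end).
  move=> [A B] [A' B'] /= e; congr (_, _); apply: funext => x.
    exact: (congr1 (@^~ (inl x)) e).
  exact: (congr1 (@^~ (inr x)) e).
by apply/embeds_set/idem_sum; apply: embeds_refl.
Qed.

Lemma idem_fun A B : embeds A X -> embeds B (set X) -> embeds (A -> B) (set X).
Proof.
move=> AX BX; apply: embeds_trans (embeds_fun _ BX) _.
apply: embeds_trans (@embeds_uncurry A X) _.
by apply/embeds_set/idem_prod => //; apply: embeds_refl.
Qed.

End Idempotent.

(** Zorn's lemma gives a maximal subset [A] with a coding of its pairs in [A]. If the complement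
    embeds in [A], so does [K]; otherwise the complement contains a copy of [A], whose points can
    code the pairs of an enlarged set. *)
Lemma infinite_idem K : embeds nat K -> embeds (K * K) K.
Proof.
move=> natK.
(* A triple (x, y, z) of [G] says that z codes (x, y); a pair may have several codes,
   so a choice function turns a maximal [G] into an injection. *)
pose base (G : set (K * K * K)) : set K := fun x => exists z, G (x, x, z).
pose ok G := [/\ forall x y z, G (x, y, z) -> [/\ base G x, base G y & base G z],
  forall x y, base G x -> base G y -> exists z, G (x, y, z),
  forall p q z, G (p, z) -> G (q, z) -> p = q &
  (* The premise exempts the empty set, so that the union of an empty chain qualifies. *)
  forall p, G p -> embeds nat {x | base G x}].
have baseS G G' : G `<=` G' -> base G `<=` base G'.
  by move=> GG' x [z Gz]; exists z; apply: GG'.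
have embS (A B : set K) : A `<=` B -> embeds {x | A x} {x | B x}.
  move=> AB; exists (fun x => exist B (sval x) (AB _ (svalP x))).
  by move=> [x px] [y py] /= [e]; apply: eq_exist.
have [|G [[G1 G2 G3 G4] Gmax]] := @Zorn_bigcup _ ok.
  move=> F FP Ftot.
  have sub G : F G -> G `<=` \bigcup_(X in F) X by move=> FG p Gp; exists G.
  have two p q : (\bigcup_(X in F) X) p -> (\bigcup_(X in F) X) q ->
      exists2 G, F G & G p /\ G q.
    move=> [G FG Gp] [G' FG' Gq].
    have [/(_ p Gp)|/(_ q Gq)] := Ftot _ _ FG FG' => ?; by [exists G'|exists G].
  split.
  - move=> x y z [G FG Gp]; have [+ _ _ _] := FP _ FG.
    by move=> /(_ _ _ _ Gp)[? ? ?]; split; apply: baseS (sub _ FG) _ _.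
  - move=> x y [z Gx] [z' Gy]; have [G FG [{}Gx {}Gy]] := two _ _ Gx Gy.
    have [_ + _ _] := FP _ FG.
    by case/(_ x y) => [||t Gt]; [exists z|exists z'|exists t; apply: sub FG _ _].
  - move=> p q z Gp Gq; have [G FG [{}Gp {}Gq]] := two _ _ Gp Gq.
    by have [_ _ + _] := FP _ FG; apply; eassumption.
  - move=> p [G FG Gp]; have [_ _ _ /(_ _ Gp)natG] := FP _ FG.
    by apply: embeds_trans natG _; apply/embS/baseS/sub.
pose A := ({x | base G x} : Type).
have [natA|Gn] : embeds nat A \/ forall p, ~ G p.
  by have [[p /G4]|/forallNP] := pselect (exists p, G p); [left|right].
- pose B := ({x | ~ base G x} : Type).
  have idA : idem A.
    split=> //; have tot (p : A * A) : exists z : A, G (sval p.1, sval p.2, sval z).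
      have [z Gz] := G2 _ _ (svalP p.1) (svalP p.2).
      by have [_ _ bz] := G1 _ _ _ Gz; exists (exist _ z bz).
    have [f fG] := choice tot; exists f => p q e.
    have := fG q; rewrite -e => /(G3 _ _ _ (fG p)) [].
    by case: p q {e} => [[x ?] [y ?]] [[x' ?] [y' ?]] /= ? ?; congr (_, _); apply: eq_exist.
  have [BA|[j jI]] := embeds_total B A.
    have KA : embeds K A.
      apply: embeds_trans (idem_sum idA (embeds_refl A) BA).
      exists (fun x => match pselect (base G x) with
        left h => inl (exist _ x h) | right h => inr (exist _ x h) end).
      by move=> x y; case: pselect => ?; case: pselect => ? // [].
    apply: embeds_trans (idem_prod idA KA KA) _; exact: embeds_sig.
  pose A' : set K := fun x => base G x \/ exists a, x = sval (j a).
  have [f fI] : embeds ({x | A' x} * {x | A' x}) A.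
    have A'A : embeds {x | A' x} A.
      apply: embeds_trans (idem_sum idA (embeds_refl A) (embeds_refl A)).
      have tot (x : {x | A' x}) : exists s : A + A,
          sval x = match s with inl a => sval a | inr a => sval (j a) end.
        by case: x => x /= [bx|[a ->]]; [exists (inl (exist _ x bx))|exists (inr a)].
      have [g gP] := choice tot; exists g => x y e.
      by move: (gP x); rewrite e -gP; case: x y {e} => ? ? [? ?] /= ?; apply: eq_exist.
    exact: idem_prod.
  (* New pairs get codes in the copy [j], outside [base G], so they never clash with old codes. *)
  pose G' : set (K * K * K) := fun q => G q \/
    ~ (base G q.1.1 /\ base G q.1.2) /\
    exists p, q = (sval p.1, sval p.2, sval (j (f p))).
  have bG' : base G' = A'.
    apply/seteqP; split=> x.
      move=> [z [Gz|[_ [[[a ha] b] /= [-> _ _]]]]] //; by left; exists z.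
    move=> A'x; have [[z Gz]|bN] := pselect (base G x); first by exists z; left.
    pose x' := exist _ x A'x.
    by exists (sval (j (f (x', x')))); right; split=> [[]//|]; exists (x', x').
  have GG' : G `<=` G' by left.
  case: (Gmax G').
    split=> //; have [a _] := natA => sub.
    have : base G' (sval (j (a 0))) by rewrite bG'; right; exists (a 0).
    by case=> z /sub Gz; apply: (svalP (j (a 0))); have [] := G1 _ _ _ Gz.
  split.
  - rewrite bG' => x y z [/G1[? ? ?]|[_ [[[x1 h1] [y1 h2]] /= [-> -> ->]]]].
      by split; left.
    by split=> //; right; eexists.
  - rewrite bG' => x y A'x A'y.
    have [[bx by_]|xyN] := pselect (base G x /\ base G y).
      by have [z Gz] := G2 _ _ bx by_; exists z; left.
    pose p := (exist _ x A'x, exist _ y A'y).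
    by exists (sval (j (f p))); right; split=> //; exists p.
  - move=> p q z [Gp|[_ [p' [-> ez]]]] [Gq|[_ [q' [-> ez']]]].
    + exact: G3 Gp Gq.
    + by case: p Gp => x y /G1[_ _]; rewrite ez' => /(svalP (j _)).
    + by case: q Gq => x y /G1[_ _]; rewrite ez => /(svalP (j _)).
    + have : j (f p') = j (f q') by apply: eq_sig_hprop; rewrite -?ez.
      by move=> /jI/fI ->.
  - move=> _ _; apply: embeds_trans natA _; apply: embS; exact: baseS.
(* An empty maximal [G] is refuted by the pairing function on a countable subset. *)
- case: natK => e eI.
  pose G0 : set (K * K * K) := fun q => exists m n, q = (e m, e n, e (pickle (m, n))).
  have bG0 n : base G0 (e n) by exists (e (pickle (n, n))), n, n.
  case: (Gmax G0).
    split=> [p /Gn//|/(_ (e 0, e 0, e (pickle (0, 0))))] /(_ _)/Gn; apply.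
    by exists 0, 0.
  split.
  - by move=> x y z [m [n [-> -> ->]]].
  - by move=> x y [z [m [_ [-> _ _]]]] [t [n [_ [-> _ _]]]]; eexists; exists m, n.
  - move=> p q z [m [n [-> ->]]] [m' [n' [-> /eI]]].
    by move=> /(pcan_inj pickleK)[-> ->].
  - by move=> _ _; exists (fun n => exist _ (e n) (bG0 n)) => m n [] /eI.
Qed.

(** * Systems of almost disjoint sets *)

Lemma card_le_embeds T T' (A : set T) (B : set T') :
  A #<= B <-> embeds {x | A x} {x | B x}.
Proof.
split=> [/card_leP/injfunPex[f _ fI]|[f fI]].
  exists (fun x => let y := f (exist _ (sval x) (mem_set (svalP x))) in
    exist _ (sval y) (set_mem (svalP y))).
  move=> x y /= [/eq_sig_hprop e]; apply: eq_sig_hprop => //.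
  have /fI : f (exist _ (sval x) (mem_set (svalP x))) =
             f (exist _ (sval y) (mem_set (svalP y))) by apply: e.
  by rewrite !inE => /(_ I I) [].
apply/card_leP/injfunPex.
exists (fun x : A => let y := f (exist _ (sval x) (set_mem (svalP x))) in
  exist _ (sval y) (mem_set (svalP y)) : B) => // x y _ _ /= [e].
have /fI[] : f (exist _ (sval x) (set_mem (svalP x))) =
             f (exist _ (sval y) (set_mem (svalP y))) by apply: eq_sig_hprop.
by move=> ?; apply: eq_sig_hprop.
Qed.

Lemma card_eq_embeds T K (A : set T) :
  A #= [set: K] <-> embeds {x | A x} K /\ embeds K {x | A x}.
Proof.
have KT : embeds K {x | [set: K] x} by exists (fun x => exist _ x I) => x y [].
have TK : embeds {x | [set: K] x} K by exact: embeds_sig.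
rewrite card_eq_le; split=> [/andP[/card_le_embeds AK /card_le_embeds KA]|[AK KA]].
  by split; [exact: embeds_trans AK TK|exact: embeds_trans KT KA].
by apply/andP; split; apply/card_le_embeds;
  [exact: embeds_trans AK KT|exact: embeds_trans TK KA].
Qed.

Definition almost_disjoint I T (F : I -> set T) : Prop :=
  forall i j, i <> j -> forall x y, F i x -> F j x -> F i y -> F j y -> x = y.

(** Equal members at distinct indices would share two points, since members are infinite. *)
Lemma system_2_intro I K T (F : I -> set T) : embeds nat K ->
  (forall i, F i #= [set: K]) -> almost_disjoint F -> system_2 K F.
Proof.
move=> natK FK Fdis; split=> // i j e; apply: contrapT => ij.
have [f fI] : embeds nat {x | F i x}.
  by apply: embeds_trans natK _; have /card_eq_embeds[] := FK i.
suff /fI : f 0 = f 1 by [].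
by apply: eq_sig_hprop => //; apply: (Fdis _ _ ij); rewrite -?e; apply: svalP.
Qed.

(* [enc] separates the points of [B] outside the image, so there are at most two of them. *)
Lemma card_eq_almost_image K T T' (A : set T) (B : set T') (f : T -> T') (enc : T' -> bool) :
    idem K -> injective f -> A #= [set: K] -> (forall x, A x -> B (f x)) ->
    (forall y y', B y -> B y' -> ~ (f @` A) y -> ~ (f @` A) y' ->
       enc y = enc y' -> y = y') ->
  B #= [set: K].
Proof.
move=> idK fI /card_eq_embeds[AK KA] AB encI; apply/card_eq_embeds; split.
  apply: embeds_trans (idem_sum idK AK (idem_fin idK bool)).
  have tot (y : {y | B y}) : exists s : {x | A x} + bool, match s with
      | inl x => sval y = f (sval x)
      | inr b => ~ (f @` A) (sval y) /\ enc (sval y) = b end.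
    have [[x Ax e]|] := pselect ((f @` A) (sval y)); last by exists (inr (enc (sval y))).
    by exists (inl (exist _ x Ax)).
  have [g gP] := choice tot; exists g => y y' e; apply: eq_sig_hprop => //.
  move: (gP y) (gP y'); rewrite e; case: (g y') => [x -> -> //|b [? <-] [? ?]].
  by apply: encI => //; exact: svalP.
apply: embeds_trans KA _; exists (fun x => exist _ (f (sval x)) (AB _ (svalP x))).
by move=> x y [/fI e]; exact: eq_sig_hprop.
Qed.

(** * Families without a weak conflict free colouring *)

Definition bad_family (K I T : Type) (F : I -> set T) (n : nat) : Prop :=
  [/\ forall i, F i #= [set: K], almost_disjoint F &
      ~ exists f : T -> option 'I_n, weak_CF_coloring F f].

(** The bound on [T] lets one cardinal control sets and points in the next extension. *)
Definition bad (K I : Type) (n : nat) : Prop :=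
  exists (T : Type) (F : I -> set T), embeds T I /\ bad_family K F n.

Lemma card_eq_injimage K T T' (A : set T) (f : T -> T') :
  injective f -> A #= [set: K] -> f @` A #= [set: K].
Proof.
move=> fI; apply: card_eq_trans; apply/card_eqPle; split; first exact: card_image_le.
apply/card_le_embeds; exists (fun x => exist _ (f (sval x)) (imageP f (svalP x))).
by move=> x y [/fI e]; apply: eq_sig_hprop.
Qed.

(** Indices outside the image of [I] receive pairwise disjoint sets of new points; a colouring of
    the padded family restricts to one of [F]. *)
Lemma bad_pad K I J T (F : I -> set T) n :
    idem J -> embeds K J -> embeds I J -> embeds T J ->
  bad_family K F n -> bad K J n.
Proof.
move=> idJ KJ [e eI] TJ [FK Fdis nF].
pose F' j : set (T + K * J) := match pselect (exists i, e i = j) with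
  | left h => inl @` F (projT1 (cid h)) | right _ => inr @` (fun p => p.2 = j) end.
have F'e i : F' (e i) = inl @` F i.
  rewrite /F'; case: pselect => [h|[]]; last by exists i.
  by have /eI -> := projT2 (cid h).
exists (T + K * J)%type, F'; split.
  exact (idem_sum idJ TJ (idem_prod idJ KJ (embeds_refl J))).
split.
- move=> j; rewrite /F'; case: pselect => [h|_].
    by apply: card_eq_injimage => // x y [].
  apply: card_eq_injimage => [x y []//|]; apply/card_eq_embeds; split.
    exists (fun p => (sval p).1) => -[[k j1] /= e1] [[k' j2] /= e2] /= e3.
    by apply: eq_exist; rewrite e1 e2 e3.
  by exists (fun k => exist (fun p : K * J => p.2 = j) (k, j) erefl) => k k' [].
- move=> i j ij x y; rewrite /F'; case: pselect => hi; case: pselect => hj.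
  + have inlI : injective (@inl T (K * J)) by move=> ? ? [].
    move=> [t Ft <-] + [u Fu <-]; rewrite !image_inj // => Ft' Fu'.
    congr inl; apply: Fdis Ft Ft' Fu Fu' => e'.
    by apply: ij; rewrite -(projT2 (cid hi)) -(projT2 (cid hj)) e'.
  + by move=> [t _ <-] [].
  + by move=> [t _ <-] [].
  + by move=> [t ti <-] [t' tj [e']]; case: ij; rewrite -ti -tj e'.
- move=> [f fCF]; apply: nF; exists (f \o inl) => i.
  have [z [x [[+ fx] xU]]] := fCF (e i); rewrite F'e => -[t Ft et]; exists z, t.
  split=> [|t' [Ft' ft']]; first by split=> //=; rewrite et.
  suff : inl t = inl t' :> T + K * J by case.
  by rewrite et; apply: xU; rewrite F'e; split=> //; exists t'.
Qed.

(* The points of one colour on the two disjoint rows cannot be one on each row: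
   these two points would lie together on a transversal set. *)
Lemma bad_base K : idem K -> bad K K 1.
Proof.
move=> idK; have bK := idem_fin idK bool.
have K1 := embeds_refl K; have KK := idem_prod idK K1 K1.
(* Two rows, and for each transversal [(a, b)] a stock of private points bringing it to size |K|. *)
pose P := (bool * K + K * K * K)%type.
pose F (i : bool + K * K) : set P := match i with
  | inl b => fun p => if p is inl q then q.1 = b else False
  | inr ab => fun p => match p with
      | inl q => q.2 = if q.1 then ab.1 else ab.2
      | inr q => q.1 = ab end
  end.
apply: (@bad_pad K (bool + K * K) K P F) => //; first exact: idem_sum.
  by apply: (idem_sum idK); exact: idem_prod.
split.
- case=> [b|ab].
    have -> : F (inl b) = (fun k => inl (b, k)) @` [set: K].
      apply/seteqP; split=> [[[b' k]|//] /= <-|_ [k _ <-] //].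
      by exists k.
    by apply: card_eq_injimage => // k k' [].
  pose enc (p : P) := if p is inl q then q.1 else true.
  apply: (@card_eq_almost_image K _ _ [set: K] _ (fun k => inr (ab, k)) enc) => //.
    by move=> k k' [].
  move=> [[b k]|[ab1 k]] [[b' k']|[ab2 k']] //= e1 e2 n1 n2 e3.
  - by rewrite e1 e2 e3.
  - by case: n2; exists k'; rewrite ?e2.
  - by case: n1; exists k; rewrite ?e1.
  - by case: n1; exists k; rewrite ?e1.
- move=> [b|[a b]] [b'|[a' b']] ij [[c k]|[c k]] [[d l]|[d l]] //=.
  - by move=> -> e; case: ij; rewrite e.
  - by move=> -> -> -> ->.
  - by move=> -> -> -> ->.
  - by move=> -> e -> e'; move: c d e e' ij => [] [] /= e e' ij //; case: ij; rewrite e e'.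
  - by move=> _ _ -> e; case: ij; rewrite e.
  - by move=> -> e; case: ij; rewrite e.
  - by move=> -> e; case: ij; rewrite e.
- move=> [f fCF].
  have row b : exists k, exists z, f (inl (b, k)) = Some z.
    have [z [p [[Fb fz] _]]] := fCF (inl b).
    by case: p Fb fz => [[b' k]|p] //= -> fz; exists k, z.
  have [[a [za fa]] [b [zb fb]]] := (row true, row false).
  have [z [p [_ pU]]] := fCF (inr (a, b)).
  have /pU ea : F (inr (a, b)) (inl (true, a)) /\ f (inl (true, a)) = Some z.
    by rewrite fa !ord1.
  have /pU : F (inr (a, b)) (inl (false, b)) /\ f (inl (false, b)) = Some z.
    by rewrite fb !ord1.
  by rewrite ea.
Qed.

(** * One extension *)

Section Extension.
Variables (K I T C : Type) (F : I -> set T).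

(** A point of a batch: the first component names its row, the second its place in the row. *)
Definition row_pt : Type := set I * K.
Definition slot : Type := (I -> row_pt) * I.
(* The value [None] is for the colours that are not frequent enough. *)
Definition node (U : Type) : Type := C * slot -> option U.
(** Old points, and for each node its batch and a fresh copy of [T] for every colour and
    sequence. *)
Definition ext_pt (U : Type) : Type := U + node U * (row_pt + C * (I -> row_pt) * T).
Definition ext_idx (U J : Type) : Type := J + node U * (set I + C * slot).

(** Thus distinct slots receive distinct old points, and each batch point enters at most one set of
    a given copy of [F]. *)
Definition admissible U (X : node U) (s : I -> row_pt) : Prop :=
  (forall w w' u, X w = Some u -> X w' = Some u -> w = w') /\ injective s.

(* If [admissible X s] fails, the two extra points are left out, so that every index
   still yields a set. *)
Definition ext_fam U J (G : J -> set U) (j : ext_idx U J) : set (ext_pt U) :=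
  match j with
  | inl j => fun p => if p is inl u then G j u else False
  | inr (X, inl h) => fun p =>
      if p is inr (X', inl y) then X' = X /\ y.1 = h else False
  | inr (X, inr (c, (s, i))) => fun p =>
      match p with
      | inl u => admissible X s /\ X (c, (s, i)) = Some u
      | inr (X', inl y) => [/\ admissible X s, X' = X & y = s i]
      | inr (X', inr (c', s', t)) => [/\ X' = X, c' = c, s' = s & F i t]
      end
  end.

(** Slot sets of different nodes share only old points, and each has at most one. At the same node
    they share no old point, and a common batch point together with a common copy point would force
    equal slots. *)
Lemma ext_almost_disjoint U J (G : J -> set U) :
  almost_disjoint F -> almost_disjoint G -> almost_disjoint (ext_fam G).
Proof.
move=> Fdis Gdis.
have slotP (X X' : node U) w w' u : (forall w w' u, X w = Some u -> X w' = Some u -> w = w') ->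
    X = X' -> X w = Some u -> X' w' = Some u ->
    inr (X, inr w) = inr (X', inr w') :> ext_idx U J.
  by move=> XI <- e e'; rewrite (XI _ _ _ e e').
move=> [j|[X [h|[c [s i]]]]] [j'|[X' [h'|[c' [s' i']]]]] ab
  [u|[X1 [y|[[c1 s1] t]]]] [v|[X2 [z|[[c2 s2] t']]]] //=.
- by move=> *; congr inl; apply: (Gdis j j') => // e; apply: ab; rewrite e.
- by move=> _ [_ e] _ [_]; rewrite e => -[->].
- by move=> [e eh] [e' eh'] _ _; case: ab; rewrite -e -e' -eh -eh'.
- by move=> [-> _] [_ _ ->] [-> _] [_ _ ->].
- by move=> [_ e] _ [_]; rewrite e => -[->].
- by move=> [_ -> ->] _ [_ -> ->].
- by move=> [_ e] _ [_]; rewrite e => -[->].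
- by move=> [[XI _] e] [_ e'] [_ eX _] [_ eX' _]; case: ab; apply: slotP XI _ e e'; rewrite -eX.
- by move=> [[XI _] e] [_ e'] [eX _ _ _] [eX' _ _ _]; case: ab; apply: slotP XI _ e e'; rewrite -eX.
- by move=> [_ eX _] [_ eX' _] [[XI _] e] [_ e']; case: ab; apply: slotP XI _ e e'; rewrite -eX.
- by move=> [_ -> ->] _ [_ -> ->].
- move=> [[_ sI] eX ->] [_ eX' e] [_ ec es _] [_ ec' es' _]; case: ab.
  move: e; rewrite -eX -eX' -ec -ec' -es' es => /sI ->.
  by [].
- by move=> [eX _ _ _] [eX' _ _ _] [[XI _] e] [_ e']; case: ab; apply: slotP XI _ e e'; rewrite -eX.
- move=> [_ ec es _] [_ ec' es' _] [[_ sI] eX ->] [_ eX' e]; case: ab.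
  move: e; rewrite -eX -eX' -ec -ec' -es' es => /sI ->.
  by [].
- move=> [eX ec es Ft] [eX' ec' es' Ft'] [-> -> -> Fu] [_ _ _ Fu'].
  rewrite eX ec es; congr (inr (_, inr (_, _))); apply: (Fdis i i') => // e; case: ab.
  by rewrite -eX -ec -es e -eX' -ec' -es'.
Qed.

Lemma ext_card U J (G : J -> set U) : idem K ->
    (forall i, F i #= [set: K]) -> (forall j, G j #= [set: K]) ->
  forall j, ext_fam G j #= [set: K].
Proof.
move=> idK FK GK [j|[X [h|[c [s i]]]]].
- have -> : ext_fam G (inl j) = inl @` G j.
    by apply/seteqP; split=> [[u|//] Gu|_ [u Gu <-] //]; exists u.
  by apply: card_eq_injimage => // x y [].
- have -> : ext_fam G (inr (X, inl h)) = (fun k => inr (X, inl (h, k))) @` [set: K].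
    apply/seteqP; split=> [[//|[X' [[h' k]|//]]] [-> /= <-]|_ [k _ <-] //].
    by exists k.
  by apply: card_eq_injimage => // x y [].
- pose enc (p : ext_pt U) := if p is inl _ then true else false.
  pose emb t : ext_pt U := inr (X, inr (c, s, t)).
  apply: (card_eq_almost_image (f := emb) (enc := enc) idK _ (FK i)) => //.
    by move=> x y [].
  move=> [u|[X1 [y|[[c1 s1] t]]]] [v|[X2 [z|[[c2 s2] t']]]] //=.
  + by move=> [_ ->] [_ [->]].
  + by move=> [_ -> ->] [_ -> ->].
  + by move=> _ [-> -> -> Ft] _ []; exists t'.
  + by move=> [-> -> -> Ft] _ []; exists t.
  + by move=> [-> -> -> Ft] _ []; exists t.
Qed.

End Extension.

(* After identifying [H] with [C -> H], one of the fibres of [d] projects onto the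
   corresponding factor, for otherwise a diagonal argument yields a point without colour. *)
Lemma pigeonhole (C H : Type) (d : H -> C) : embeds (C -> H) H ->
  exists c (g : H -> H), injective g /\ forall h, d (g h) = c.
Proof.
move=> [phi phiI].
have [c cP] : exists c, forall h, exists x : C -> H, x c = h /\ d (phi x) = c.
  apply: contrapT => /forallNP N.
  have /choice[x xP] c : exists h, forall x : C -> H, x c = h -> d (phi x) <> c.
    have /existsNP[h /forallNP hP] := N c.
    by exists h => x xc dx; apply: (hP x).
  exact: (xP (d (phi x)) x).
have [x xP] := choice cP.
exists c, (phi \o x); split=> [h h' /phiI e|h]; last by have [] := xP h.
by rewrite -(xP h).1 e (xP h').1.
Qed.

(** The colour occurs at least $2^{|I|}$ times, since this is the size of [slot]. *)
Definition large (C K I U : Type) (f : U -> option C) (c : C) : Prop :=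
  exists e : slot K I -> U, injective e /\ forall w, f (e w) = Some c.

Lemma ext_large (K I T U J : Type) (n : nat) (F : I -> set T) (G : J -> set U)
    (f : ext_pt K I T 'I_n.+1 U -> option 'I_n.+1) :
    embeds (slot K I) (set I) -> embeds ('I_n.+1 -> set I) (set I) ->
    ~ (exists g : T -> option 'I_n, weak_CF_coloring F g) ->
    weak_CF_coloring (ext_fam F G) f ->
  exists2 c, large K I f c & ~ large K I (f \o inl) c.
Proof.
move=> [i0 i0I] CI nF fCF.
(* The sequence [e c] lists distinct points of colour [c] if [c] is large, and is constantly [None]
   otherwise. *)
have /choice[e eP] c : exists e : slot K I -> option U,
    [/\ large K I (f \o inl) c -> forall w, exists u, e w = Some u,
        forall w u, e w = Some u -> f (inl u) = Some c &
        forall w w' u, e w = Some u -> e w' = Some u -> w = w'].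
  have [[e [eI ec]]|nL] := pselect (large K I (f \o inl) c); last by exists (fun=> None).
  exists (Some \o e); split=> [_ w|w u [<-]|w w' u [<-] [/eI]//].
  - by exists (e w).
  - exact: ec.
pose X : node K I 'I_n.+1 U := fun cw => e cw.1 cw.2.
have XI w w' u : X w = Some u -> X w' = Some u -> w = w'.
  case: w w' => [c w] [c' w'] eu eu'.
  have [_ ec eI] := eP c; have [_ ec' _] := eP c'.
  have [cc'] : Some c = Some c' by rewrite -(ec _ _ eu) (ec' _ _ eu').
  by subst c'; congr pair; apply: eI eu eu'.
have /choice[kz kzP] h : exists kz, f (inr (X, inl (h, kz.1))) = Some kz.2.
  have [z [p [[]]]] := fCF (inr (X, inl h)).
  by case: p => [//|[X' [[h' k]|//]]] [-> /= ->] fz _; exists (k, z).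
(* Each row has a chosen coloured point; [g] selects $2^{|I|}$ rows whose chosen points share the
   colour [c]. *)
have [c [g [gI gc]]] := pigeonhole (snd \o kz) CI.
pose e0 h : row_pt K I := (g h, (kz (g h)).1).
have e0I : injective e0 by move=> h h' [/gI].
have fe0 h : f (inr (X, inl (e0 h))) = Some c by rewrite kzP -(gc h).
exists c => [|L].
  exists (fun w => inr (X, inl (e0 (i0 w)))); split=> // w w' [] e1 e2.
  by apply/i0I/e0I; congr pair.
have [j jI] := @embeds_set1 I.
pose s i := e0 (j i).
have Xs : admissible X s by split=> // i i' /e0I/jI.
(* Points of colour [c] become uncoloured, and [unlift] renumbers the other [n] colours. *)
apply: nF; exists (fun t => obind (unlift c) (f (inr (X, inr (c, s, t))))) => i.
have [z [p [[Fp fp] pU]]] := fCF (inr (X, inr (c, (s, i)))).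
have [z' zE|zc] := unliftP c z; last first.
  (* If [z] were [c], an old point and a batch point would both be the unique point of that
     colour. *)
  have [LX eX _] := eP c; have [u Xu] := LX L (s, i).
  have /pU pE : ext_fam F G (inr (X, inr (c, (s, i)))) (inl u) /\ f (inl u) = Some z.
    by rewrite zc (eX _ _ Xu).
  have /pU : ext_fam F G (inr (X, inr (c, (s, i)))) (inr (X, inl (s i))) /\
      f (inr (X, inl (s i))) = Some z.
    by rewrite zc fe0.
  by rewrite pE.
have zc : z <> c by move=> zc; have /eqP := neq_lift c z'; rewrite -zE zc.
case: p Fp fp pU => [u|[X' [y|[[c' s'] t]]]].
- move=> [_ Xu]; have [_ eX _] := eP c.
  by rewrite (eX _ _ Xu) => -[/esym/zc].
- by move=> [_ -> ->]; rewrite fe0 => -[/esym/zc].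
move=> [-> -> -> Ft] ft tU; exists z', t; split=> [|t' [Ft' ft']].
  by split=> //; rewrite ft /= zE liftK.
suff /tU[] : ext_fam F G (inr (X, inr (c, (s, i)))) (inr (X, inr (c, s, t'))) /\
    f (inr (X, inr (c, s, t'))) = Some z by [].
split=> //; case: (f _) ft' => //= z1; case: unliftP => // z2 -> [->].
by rewrite zE.
Qed.

(** * Iterated extensions *)

Lemma ext_coloring K I T C U J (F : I -> set T) (G : J -> set U) n
    (f : ext_pt K I T C U -> option 'I_n) :
  weak_CF_coloring (ext_fam F G) f -> weak_CF_coloring G (f \o inl).
Proof.
move=> fCF j; have [z [p [[Gp fp] pU]]] := fCF (inl j); case: p Gp fp pU => // u Gu fu uU.
by exists z, u; split=> // v [Gv fv]; have [] := uU (inl v) (conj Gv fv).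
Qed.

Section Tower.
Variables (K I T : Type) (n : nat) (F : I -> set T).
Hypotheses (idK : idem K) (idI : idem I) (KI : embeds K I) (TI : embeds T I).
Hypothesis badF : bad_family K F n.

Let H : Type := set I.
Let Z : Type := set (set I).
Let idH : idem H := idem_powerset idI.
Let idZ : idem Z := idem_powerset idH.
Let IH : embeds I H := @embeds_set1 I.
Let HZ : embeds H Z := @embeds_set1 H.
Let IZ : embeds I Z := embeds_trans IH HZ.

Lemma rows_embeds : embeds (I -> row_pt K I) H.
Proof.
apply (idem_fun idI (embeds_refl I)).
exact (idem_prod idH (embeds_refl H) (embeds_trans KI IH)).
Qed.

Lemma slot_embeds : embeds (slot K I) H.
Proof. exact (idem_prod idH rows_embeds IH). Qed.

(** Here the second power set is spent: $(2^{2^{|I|}})^{2^{|I|}} = 2^{2^{|I|}}$. *)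
Lemma node_embeds U : embeds U Z -> embeds (node K I 'I_n.+1 U) Z.
Proof.
move=> UZ; apply (idem_fun idH); last exact: idem_option.
exact (idem_prod idH (idem_fin idH _) slot_embeds).
Qed.

Lemma ext_pt_embeds U : embeds U Z -> embeds (ext_pt K I T 'I_n.+1 U) Z.
Proof.
move=> UZ; apply (idem_sum idZ UZ); apply (idem_prod idZ (node_embeds UZ)).
apply: embeds_trans HZ; apply (idem_sum idH).
  exact (idem_prod idH (embeds_refl H) (embeds_trans KI IH)).
apply (fun h => idem_prod idH h (embeds_trans TI IH)).
exact (idem_prod idH (idem_fin idH _) rows_embeds).
Qed.

Lemma ext_idx_embeds U J : embeds U Z -> embeds J Z ->
  embeds (ext_idx K I 'I_n.+1 U J) Z.
Proof.
move=> UZ JZ; apply (idem_sum idZ JZ); apply (idem_prod idZ (node_embeds UZ)).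
apply: embeds_trans HZ; apply (idem_sum idH (embeds_refl H)).
exact (idem_prod idH (idem_fin idH _) slot_embeds).
Qed.

Lemma tower (k : nat) : exists (U J : Type) (G : J -> set U),
  [/\ embeds U Z, embeds J Z, forall j, G j #= [set: K], almost_disjoint G &
    forall f : U -> option 'I_n.+1, weak_CF_coloring G f ->
      exists s, [/\ uniq s, size s = k & {in s, forall c, large K I f c}]].
Proof.
have [FK Fdis nF] := badF.
elim: k => [|k [U [J [G [UZ JZ GK Gdis Glarge]]]]].
  (* The iteration starts from the empty family. *)
  exists void, void, (fun j : void => match j with end).
  have voidZ : embeds void Z by exists (fun j : void => match j with end) => -[].
  by split; [exact: voidZ|exact: voidZ|case|case|move=> f _; exists [::]].
exists (ext_pt K I T 'I_n.+1 U), (ext_idx K I 'I_n.+1 U J), (ext_fam F G); split.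
- exact: ext_pt_embeds.
- exact: ext_idx_embeds.
- exact: ext_card.
- exact: ext_almost_disjoint.
move=> f fCF; have [s [su <- sL]] := Glarge _ (ext_coloring fCF).
have CH : embeds ('I_n.+1 -> H) H.
  exact (idem_fun idI (idem_fin idI _) (embeds_refl H)).
have [c Lc nLc] := ext_large slot_embeds CH nF fCF.
(* The new colour was not large among the old points, hence is not in [s]; colours in [s] stay
   large. *)
exists (c :: s); split=> //=; first by rewrite su andbT; apply/negP=> /sL.
move=> c'; rewrite inE => /predU1P[-> //|/sL[e [eI ec]]].
by exists (inl \o e); split=> // w w' [/eI].
Qed.

Lemma bad_step : bad K Z n.+1.
Proof.
(* One more distinct colour than there are in ['I_n.+1]. *)
have [U [J [G [UZ JZ GK Gdis Glarge]]]] := tower n.+2.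
apply: bad_pad idZ (embeds_trans KI IZ) JZ UZ _.
split=> // -[f /Glarge[s [su ss _]]].
by have := max_card (mem s); rewrite (card_uniqP su) ss card_ord ltnn.
Qed.

End Tower.

Lemma bad_bethT K m : embeds nat K ->
  [/\ idem (bethT m K), embeds K (bethT m K) & bad K (bethT m K) m./2.+1].
Proof.
move=> natK; have idK : idem K by split; [|exact: infinite_idem].
have idB r : idem (bethT r K) /\ embeds K (bethT r K).
  elim: r => [|r [idr Kr]]; first by split=> //; exact: embeds_refl.
  by split; [exact: idem_powerset|exact: embeds_trans Kr (@embeds_set1 _)].
(* Two consecutive values are carried along because [bad_step] advances by two power sets. *)
suff [] : bad K (bethT m K) m./2.+1 /\ bad K (bethT m.+1 K) m.+1./2.+1.
  by have [] := idB m; split.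
elim: m => [|m [Pm Pm1]].
  have Pm := bad_base idK; split=> //.
  have [T [F [TK badF]]] := Pm; have KS := @embeds_set1 K.
  by apply: (bad_pad _ _ _ _ badF) => //; [exact: idem_powerset|exact: embeds_trans TK KS].
split=> //; have [T [F [TI badF]]] := Pm; have [idI KI] := idB m.
exact (bad_step idK idI KI TI badF).
Qed.

Theorem theorem6p8 (K : Type) (hK : infinite_set [set: K]) (m : nat) :
  exists (T : Type) (F : bethT m K -> set T),
    system_2 K F /\ wchiCF_ge F (m %/ 2 + 2).
Proof.
have natK : embeds nat K.
  have /infiniteP/card_le_embeds natK := hK.
  apply: embeds_trans (embeds_trans natK (@embeds_sig _ _)).
  by exists (fun x => exist _ x I) => x y [].
have [_ _ [T [F [_ [FK Fdis nF]]]]] := bad_bethT m natK.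
exists T, F; split; first exact: system_2_intro.
(* A colouring with fewer colours is also one with [m./2.+1] colours. *)
move=> rho; rewrite divn2 addn2 ltnS => le_rho [f fCF]; apply: nF.
exists (fun x => omap (widen_ord le_rho) (f x)) => i.
have [z [x [[Fx fx] xU]]] := fCF i.
exists (widen_ord le_rho z), x; split=> [|y [Fy]]; first by rewrite fx.
case fy: (f y) => [z'|//] /= [e]; apply: xU; split=> //.
by rewrite fy; congr Some; apply: val_inj.
Qed.
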